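(* Let $F=\{\mathbf{p}_0,\ldots,\mathbf{p}_n\}\subset\mathbb{R}^d$ be a finite set of points not contained in any $(d-1)$-dimensional affine subspace of $\mathbb{R}^d$, and let $k\in\mathbb{N}$. Then there exists $\delta_k=\delta_k(F)>0$ such that for every $\lambda\in(1-\delta_k,1)$, the homogeneous IFS $\Phi=\{S_i\}_{i=0}^n$ with $S_i(\mathbf{x})=\lambda\mathbf{x}+(1-\lambda)\mathbf{p}_i$ satisfies $X_k=\mathrm{int}(X)$.
   Context: Write $\mathcal{D}=\{0,\ldots,n\}$. For $\lambda\in(0,1)$, $X\subset\mathbb{R}^d$ denotes the unique non-empty compact set with $X=\bigcup_{i\in\mathcal{D}}S_i(X)$, and $\mathrm{int}(X)$ is its interior in $\mathbb{R}^d$. The coding map $\pi:\mathcal{D}^{\mathbb{N}}\to X$ is $\pi(\mathbf{a})=\lim_{j\to\infty}(S_{a_1}\circ\cdots\circ S_{a_j})(\mathbf{0})$; a sequence $\mathbf{a}$ with $\pi(\mathbf{a})=\mathbf{x}$ is a coding of $\mathbf{x}$. For $\mathbf{b}\in\mathcal{D}^k$ and $\mathbf{a}\in\mathcal{D}^{\mathbb{N}}$ let $\mathrm{freq}_{\mathbf{b}}(\mathbf{a})=\lim_{m\to\infty}\frac{1}{m}\#\{1\le j\le m: a_j\cdots a_{j+k-1}=\mathbf{b}\}$ when the limit exists. $\mathbf{a}$ is $k$-simply normal if $\mathrm{freq}_{\mathbf{b}}(\mathbf{a})=(n+1)^{-k}$ for every $\mathbf{b}\in\mathcal{D}^k$.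 $X_k$ is the set of $\mathbf{x}\in X$ having at least one $k$-simply normal coding. *)

(* Defs.v *)
From HB Require Import structures.
From mathcomp Require Import all_boot all_order all_algebra.
From mathcomp Require Import all_classical all_reals all_analysis.
Set Implicit Arguments. Unset Strict Implicit. Unset Printing Implicit Defensive.
Import Order.TTheory GRing.Theory Num.Theory.
Import numFieldNormedType.Exports.
Local Open Scope classical_set_scope.
Local Open Scope ring_scope.

Definition not_in_affine_hyperplane (R : realType) (d n : nat)
  (p : 'I_n.+1 -> 'rV[R]_d) : Prop :=
  ~ (exists (a : 'rV[R]_d) (c : R),
        a != 0 /\ forall i : 'I_n.+1, \sum_(j < d) a 0 j * p i 0 j = c).

Definition Smap (R : realType) (d n : nat) (lam : R)
  (p : 'I_n.+1 -> 'rV[R]_d) (i : 'I_n.+1) (x : 'rV[R]_d) : 'rV[R]_d :=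
  lam *: x + (1 - lam) *: p i.

(* (S_{a_1} o ... o S_{a_j})(x); sequences are indexed from 0 here, so
   a_1 a_2 ... of the paper is a 0, a 1, ... *)
Definition Scomp (R : realType) (d n : nat) (lam : R)
  (p : 'I_n.+1 -> 'rV[R]_d) (a : nat -> 'I_n.+1) (j : nat) (x : 'rV[R]_d)
  : 'rV[R]_d :=
  foldr (fun m y => Smap lam p (a m) y) x (iota 0 j).

Definition is_coding (R : realType) (d n : nat) (lam : R)
  (p : 'I_n.+1 -> 'rV[R]_d) (a : nat -> 'I_n.+1) (x : 'rV[R]_d) : Prop :=
  (fun j => Scomp lam p a j 0) @ \oo --> x.

Definition occ (n k : nat) (a : nat -> 'I_n.+1) (b : k.-tuple 'I_n.+1)
  (m : nat) : nat :=
  count (fun j => [forall l : 'I_k, a (j + l)%N == tnth b l]) (iota 0 m).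

Definition simply_normal (R : realType) (n k : nat) (a : nat -> 'I_n.+1)
  : Prop :=
  forall b : k.-tuple 'I_n.+1,
    (fun m : nat => (occ a b m)%:R / (m%:R : R)) @ \oo
      --> (((n.+1) ^ k)%:R : R)^-1.

Definition Xk (R : realType) (d n : nat) (lam : R)
  (p : 'I_n.+1 -> 'rV[R]_d) (k : nat) (X : set 'rV[R]_d) : set 'rV[R]_d :=
  [set x | X x /\ exists a : nat -> 'I_n.+1,
                     is_coding lam p a x /\ simply_normal R k a].

(* Main.v *)
(** Write x as a barycentre of p_0, ..., p_n: it suffices to code weights c in
    the standard simplex of R^(n+1), where S_i becomes lam c + (1 - lam) e_i.
    For lam close to 1, X is the convex hull of F (some weight is always at
    least 1 - lam and can be peeled off), so int X is the set of barycentres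
    with positive weights, and a coding using every digit has such weights.

    For the converse let K = k + 1. Concatenating all K-letter words in
    lexicographic order gives a cyclic word N containing every k-block equally
    often. It starts with r_0 ... r_n, where r_i = 0^(K-1) i; call D the rest.
    The words r_i and D all begin with 0^(k-1), so M copies of each of them,
    concatenated in any order and followed by another such concatenation, still
    show every k-block equally often. Let w_a be r_0^M ... r_n^M D^M with the
    runs of r_0 and r_a exchanged. The fixed points t_a of the maps S_(w_a) are
    t_0 + tau_a (e_a - e_0), and for M large, then lam close to 1, tau_a is at
    least (n+1)(1 - lam). The hull of the t_a, all of whose points are coded by
    concatenations of the w_a, then contains
      {c : c_i >= b_i},  where  b = t_0 - (n+1)(1 - lam) e_0.
    Finally, if c_i >= lam^(m+1) b_i for all i, the sum of c_i - lam^(m+1) b_i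
    is at least (n+1)(1 - lam), so that some digit i can be peeled off, leading
    to weights with c_i >= lam^m b_i. Positive weights satisfy this for some m,
    hence reach that set after m digits. *)
Require Import Defs.
From mathcomp Require Import all_boot all_order all_algebra all_fingroup.
From mathcomp Require Import all_classical all_reals all_analysis.
From mathcomp Require Import zify ring lra.
Set Implicit Arguments. Unset Strict Implicit. Unset Printing Implicit Defensive.
Import Order.TTheory GRing.Theory Num.Theory.
Import numFieldNormedType.Exports.

(** * Block counts in words *)

(* Counts the occurrences of [b] starting in [s], which may run over into [t]. *)
Fixpoint block_count (T : eqType) (b s t : seq T) : nat :=
  if s is _ :: s' then ((take (size b) (s ++ t) == b) + block_count b s' t)%N else 0%N.

Lemma block_count_cat (T : eqType) (b s1 s2 t : seq T) :
  block_count b (s1 ++ s2) t = (block_count b s1 (s2 ++ t) + block_count b s2 t)%N.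
Proof. by elim: s1 => //= x s1 ->; rewrite catA addnA. Qed.

Lemma take_cat_agree (T : Type) k (s t t' : seq T) :
  take k t = take k t' -> take k (s ++ t) = take k (s ++ t').
Proof.
move=> h; rewrite !take_cat; case: ifP => // _; congr (_ ++ _).
have le : (k - size s <= k)%N by rewrite leq_subr.
by rewrite -(take_takel t le) h take_takel.
Qed.

(** A window that starts in [s] reads at most [(size b).-1] letters of what follows. *)
Lemma block_count_ext (T : eqType) (b s t t' : seq T) :
  take (size b).-1 t = take (size b).-1 t' -> block_count b s t = block_count b s t'.
Proof.
move=> h; elim: s => //= x s ->.
case: (size b) h => [|k] /= h; first by [].
by rewrite (take_cat_agree s h).
Qed.

Lemma block_count_sum (T : eqType) (b s t : seq T) :
  block_count b s t = (\sum_(i < size s) (take (size b) (drop i (s ++ t)) == b))%N.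
Proof.
elim: s => [|x s IH]; first by rewrite big_ord0.
by rewrite [size (_ :: _)]/= big_ord_recl [LHS]/= IH drop0.
Qed.

(* Base [n.+1] digits of [e] modulo [n.+1 ^ K], most significant first. *)
Fixpoint digits n K e : seq 'I_n.+1 :=
  if K is K'.+1 then rcons (digits n K' (e %/ n.+1)) (inZp e) else [::].

Lemma size_digits n K e : size (digits n K e) = K.
Proof. by elim: K e => //= K IH e; rewrite size_rcons IH. Qed.

Lemma digits_cat n i j e : digits n (i + j) e = digits n i (e %/ n.+1 ^ j) ++ digits n j e.
Proof.
elim: j e => [|j IH] e; first by rewrite addn0 expn0 divn1 cats0.
by rewrite addnS /= IH -divnMA -expnS rcons_cat.
Qed.

Lemma digits_inj n K e e' : digits n K e = digits n K e' -> e = e' %[mod n.+1 ^ K].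
Proof.
elim: K e e' => [|K IH] e e'; first by rewrite expn0 !modn1.
move=> /rcons_inj[/IH h h2].
rewrite expnS (divn_eq e n.+1) (divn_eq e' n.+1) h2.
apply/eqP; rewrite eqn_modDr !(mulnC _ n.+1); apply/eqP.
by rewrite -!muln_modr h.
Qed.

Lemma digits_mul n K e : digits n K (n.+1 ^ K * e) = nseq K ord0.
Proof.
elim: K => [//|K IH] /=.
rewrite expnS -mulnA mulKn // IH -cats1 -[ord0 :: _]/(nseq K.+1 _) -[K.+1]addn1 nseqD.
congr (_ ++ [:: _]).
by apply: val_inj; rewrite /= modnMr.
Qed.

Lemma digits_small n j K e : (e < n.+1 ^ j)%N ->
  digits n (K + j) e = nseq K ord0 ++ digits n j e.
Proof. by move=> h; rewrite digits_cat divn_small // -(muln0 (n.+1 ^ K)) digits_mul. Qed.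

Lemma take_digits n i j e : take i (digits n (i + j) e) = digits n i (e %/ n.+1 ^ j).
Proof. by rewrite digits_cat take_cat size_digits ltnn subnn take0 cats0. Qed.

Lemma drop_digits n i j e : drop i (digits n (i + j) e) = digits n j e.
Proof. by rewrite digits_cat drop_size_cat // size_digits. Qed.

(* The window at offset [i] determines the last [j] digits of [e], hence those
   of [e.+1]; together with the first [i] digits of [e.+1] this gives [e.+1]. *)
Lemma window_inj n i j e e' :
  (e < n.+1 ^ (i + j))%N -> (e' < n.+1 ^ (i + j))%N ->
  digits n j e ++ take i (digits n (i + j) e.+1)
    = digits n j e' ++ take i (digits n (i + j) e'.+1) -> e = e'.
Proof.
move=> he he' /eqP; rewrite eqseq_cat ?size_digits // => /andP[/eqP/digits_inj h1].
rewrite !take_digits => /eqP/digits_inj h2.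
have {}h1 : e.+1 = e'.+1 %[mod n.+1 ^ j].
  by rewrite -(addn1 e) -(addn1 e'); apply/eqP; rewrite eqn_modDr; apply/eqP.
have : e.+1 = e'.+1 %[mod n.+1 ^ (i + j)].
  rewrite (divn_eq e.+1 (n.+1 ^ j)) (divn_eq e'.+1 (n.+1 ^ j)) h1.
  apply/eqP; rewrite eqn_modDr; apply/eqP.
  by rewrite expnD !(mulnC _ (n.+1 ^ j)) -!muln_modr h2.
rewrite -(addn1 e) -(addn1 e') => /eqP; rewrite eqn_modDr => /eqP.
by rewrite !modn_small.
Qed.

(** For fixed [i], the window of length k+1 at offset [i] runs over each word of that length exactly
    once as [e] varies, and [b] is the prefix of n+1 of these. Since [digits] reduces modulo
    [n.+1 ^ k.+1], the last [e] is followed cyclically by 0. *)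
Lemma window_count n k i (b : k.-tuple 'I_n.+1) : (i <= k.+1)%N ->
  (\sum_(e < n.+1 ^ k.+1)
     (take k (drop i (digits n k.+1 e ++ digits n k.+1 e.+1)) == b))%N = n.+1.
Proof.
move=> ik; have [j kE] : exists j, k.+1 = (i + j)%N by exists (k.+1 - i)%N; lia.
pose W e := digits n j e ++ take i (digits n k.+1 e.+1).
have sW e : size (W e) == k.+1.
  by rewrite size_cat size_digits size_take size_digits; case: ltnP => h; lia.
have WE e : take k (drop i (digits n k.+1 e ++ digits n k.+1 e.+1)) = take k (W e).
  rewrite drop_cat size_digits; case: ltnP => h.
    rewrite /W kE drop_digits -kE !take_cat !size_digits; case: ifP => // _.
    by congr (_ ++ _); rewrite take_takel //; lia.
  have -> : (i - k.+1 = 0)%N by lia.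
  have j0 : j = 0%N by lia.
  by rewrite drop0 /W j0 -[digits n 0 e]/(@nil 'I_n.+1) cat0s take_takel //; lia.
pose f (e : 'I_(n.+1 ^ k.+1)) : k.+1.-tuple 'I_n.+1 := Tuple (sW e).
have fbij : bijective f.
  apply: inj_card_bij; last by rewrite card_tuple !card_ord.
  move=> e e' /(congr1 val) /= h; apply: val_inj; apply: (@window_inj n i j).
  - by rewrite -kE; apply: ltn_ord.
  - by rewrite -kE; apply: ltn_ord.
  - by rewrite -kE.
under eq_bigr do rewrite WE.
rewrite -big_mkcond /= sum1dep_card.
have -> : [set x : 'I_(n.+1 ^ k.+1) | take k (W x) == b]
        = f @^-1: [set t | take k (val t) == b].
  by apply/setP => e; rewrite !inE.
rewrite on_card_preimset; last exact: onW_bij.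
have -> : [set t : k.+1.-tuple 'I_n.+1 | take k (val t) == b]
   = [set [tuple of rcons b x] | x : 'I_n.+1].
  apply/setP => -[t tP]; rewrite inE; apply/eqP/imsetP => /= [h|[x _ [->]]].
    exists (last ord0 t) => //; apply: val_inj => /=.
    rewrite -h; case/lastP: t tP {h} => // s x.
    by rewrite size_rcons => /eqP[<-]; rewrite last_rcons -!cats1 take_size_cat.
  by rewrite /= -cats1 take_size_cat // size_tuple.
rewrite card_imset ?card_ord // => x y /(congr1 val) /=.
by move/rcons_inj => [].
Qed.

(** Every window starting in the word of [e] ends inside the word of [e.+1], so the count splits
    word by word. *)
Lemma count_necklace n k m l (b : k.-tuple 'I_n.+1) :
  block_count b (flatten [seq digits n k.+1 e | e <- iota m l]) (digits n k.+1 (m + l))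
    = (\sum_(m <= e < m + l) block_count b (digits n k.+1 e) (digits n k.+1 e.+1))%N.
Proof.
elim: l m => [|l IH] m; first by rewrite addn0 big_geq.
rewrite /= block_count_cat addnS -addSn IH [RHS]big_ltn ?leq_addr //; congr addn.
apply: block_count_ext; rewrite [size b]size_tuple.
case: l {IH} => [|l]; first by rewrite addn0.
rewrite [iota _ _]/= [map _ _]/= [flatten _]/= -catA.
by rewrite takel_cat // size_rcons size_digits; lia.
Qed.

(* Whatever such words follow [s], a window running over the end of [s] reads
   the letters of [z], so the blocks starting in [s] do not depend on them. *)
Definition returns (T : eqType) (z s : seq T) := take (size z) (s ++ z) == z.

Lemma returns_cat (T : eqType) (z s t : seq T) :
  returns z s -> take (size z) t = z -> take (size z) (s ++ t) = z.
Proof.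
move=> /eqP zs h; rewrite -[RHS]zs; apply: take_cat_agree.
by rewrite h take_size.
Qed.

Lemma returns_flatten (T : eqType) (z : seq T) ss :
  all (returns z) ss -> returns z (flatten ss).
Proof.
elim: ss => [_|s ss IH] /=; first by rewrite /returns take_size.
case/andP=> hs /IH/eqP h; rewrite /returns -catA; apply/eqP.
exact: returns_cat.
Qed.

Lemma block_count_flatten (T : eqType) (b z : seq T) ss : size z = (size b).-1 ->
  all (returns z) ss -> block_count b (flatten ss) z = sumn [seq block_count b s z | s <- ss].
Proof.
move=> zb; elim: ss => //= s ss IH /andP[_ h].
rewrite block_count_cat IH //; congr addn; apply: block_count_ext; rewrite -zb take_size.
exact/eqP/returns_flatten.
Qed.

(** * Words built from the necklace *)

Definition necklace_tail n K :=
  flatten [seq digits n K e | e <- iota n.+1 (n.+1 ^ K - n.+1)].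

Definition run n K M i : seq 'I_n.+1 := flatten (nseq M (digits n K i)).

(** This is [w_a] of the overview: [run n K M i] is the power [r_i^M], and [necklace_tail n K] is
    [D], the necklace without its first n+1 words. *)
Definition word n K M (a : 'I_n.+1) : seq 'I_n.+1 :=
  flatten [seq run n K M (tperm ord0 a i) | i : 'I_n.+1]
    ++ flatten (nseq M (necklace_tail n K)).

(** A number below [n.+1 ^ 2] has at most two nonzero digits, so its k+1 digits begin with k-1
    zeros. *)
Lemma returns_digits n k e : (0 < k)%N -> (e < n.+1 ^ 2)%N ->
  returns (nseq k.-1 ord0) (digits n k.+1 e).
Proof.
case: k => // k _ he; rewrite -[k.+2]addn2 digits_small // /returns -catA.
by rewrite take_size_cat.
Qed.

Lemma returns_necklace_tail n k : (0 < k)%N ->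
  returns (nseq k.-1 ord0) (necklace_tail n k.+1).
Proof.
move=> k0; rewrite /necklace_tail.
(* The tail is empty if n = 0; otherwise it opens with the digits of n+1, which are k-1 zeros
   followed by 1 0. *)
case E : (n.+1 ^ k.+1 - n.+1)%N => [|l] /=; first by rewrite /returns take_size.
rewrite /returns -catA -/(digits n k.+1 n.+1); apply/eqP.
have -> : digits n k.+1 n.+1 = nseq k.-1 ord0 ++ digits n 2 n.+1.
  case: k k0 E => // k _ E; rewrite -[k.+2]addn2 digits_small //.
  case: n E => [|n _]; first by rewrite exp1n.
  by rewrite expnS expn1; nia.
by rewrite -catA take_size_cat.
Qed.

Lemma returns_nseq (T : eqType) (z s : seq T) M :
  returns z s -> all (returns z) (nseq M s).
Proof. by move=> h; rewrite all_nseq h orbT. Qed.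

Lemma returns_digits_one n k (i : 'I_n.+1) : (0 < k)%N ->
  returns (nseq k.-1 ord0) (digits n k.+1 i).
Proof.
move=> k0; apply: returns_digits => //; apply: (leq_trans (ltn_ord i)).
by rewrite expnS expn1 leq_pmulr.
Qed.

Lemma returns_runs n k M (f : 'I_n.+1 -> 'I_n.+1) : (0 < k)%N ->
  all (returns (nseq k.-1 ord0)) [seq run n k.+1 M (f i) | i : 'I_n.+1].
Proof.
move=> k0; apply/allP => s /mapP[i _ ->].
exact/returns_flatten/returns_nseq/returns_digits_one.
Qed.

Lemma returns_word n k M (a : 'I_n.+1) : (0 < k)%N ->
  returns (nseq k.-1 ord0) (word k.+1 M a).
Proof.
move=> k0; apply/eqP; rewrite -catA; apply: returns_cat.
  exact/returns_flatten/returns_runs.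
exact/eqP/returns_flatten/returns_nseq/returns_necklace_tail.
Qed.

(** All pieces satisfy [returns z], so their counts add up in any order. The total is [M] times the
    count in the cyclic necklace, to which each of the k+1 offsets contributes n+1 by
    [window_count]. *)
Lemma block_count_word n k M (b : k.-tuple 'I_n.+1) a : (0 < k)%N ->
  block_count b (word k.+1 M a) (nseq k.-1 ord0) = (M * (k.+1 * n.+1))%N.
Proof.
move=> k0; set z := nseq k.-1 ord0.
have zb : size z = (size b).-1 by rewrite size_nseq size_tuple.
have tail_ret := returns_necklace_tail n k0.
have block_count_run i : block_count b (run n k.+1 M (i : 'I_n.+1)) z
    = (M * block_count b (digits n k.+1 i) z)%N.
  rewrite block_count_flatten //; last exact/returns_nseq/returns_digits_one.
  by rewrite map_nseq sumn_nseq mulnC.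
have tails_ret := returns_nseq M tail_ret.
rewrite /word block_count_cat.
rewrite (@block_count_ext _ _ _ _ z); last first.
  by rewrite -zb take_size; apply/eqP/returns_flatten.
rewrite !block_count_flatten //; last exact: returns_runs.
rewrite map_nseq sumn_nseq -map_comp sumnE big_map big_enum /=.
under eq_bigr do rewrite block_count_run.
rewrite -big_distrr /= [X in (_ * X)%N]
  (_ : _ = \sum_(i < n.+1) block_count b (digits n k.+1 i) z)%N; last first.
  by rewrite [RHS](reindex_inj (@perm_inj _ (tperm ord0 a))).
rewrite [X in (_ + X)%N]mulnC -mulnDr; congr muln.
have le : (n.+1 <= n.+1 ^ k.+1)%N by rewrite expnS leq_pmulr // expn_gt0.
have := @count_necklace n k 0 (n.+1 ^ k.+1) b.
rewrite add0n -{1}(subnKC le) iotaD map_cat flatten_cat block_count_cat add0n.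
rewrite -/(necklace_tail n k.+1).
(* The necklace closes up: the index [n.+1 ^ k.+1] wraps round to the word of zeros, which starts
   with [z]. *)
have zE : take (size b).-1 (digits n k.+1 (n.+1 ^ k.+1)) = z.
  rewrite -[(_ ^ _)%N]muln1 digits_mul size_tuple take_nseq //.
  by lia.
rewrite (@block_count_ext _ _ (flatten _) _ z); last first.
  by rewrite -zb take_size; apply: returns_cat; rewrite ?zb.
rewrite (@block_count_ext _ _ _ _ z) ?zE -?zb ?take_size //.
rewrite block_count_flatten //; last first.
  apply/allP => s /mapP[e]; rewrite mem_iota => /andP[_ he] ->.
  apply: returns_digits => //; apply: (leq_trans he).
  by rewrite expnS expn1 leq_pmulr.
rewrite -map_comp sumnE big_map -[iota 0 n.+1]/(index_iota 0 n.+1) !big_mkord => ->.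
under eq_bigr => e _.
  rewrite block_count_sum size_digits size_tuple.
  over.
rewrite exchange_big /= (eq_bigr (fun=> n.+1)); last first.
  by move=> i _; rewrite window_count // ltnW.
by rewrite sum_nat_const card_ord.
Qed.

Lemma size_flatten_digits n K (s : seq nat) :
  size (flatten [seq digits n K e | e <- s]) = (size s * K)%N.
Proof. by elim: s => //= e s IH; rewrite size_cat size_digits IH mulSn. Qed.

Lemma size_run n K M i : size (run n K M i) = (M * K)%N.
Proof. by rewrite /run -map_nseq size_flatten_digits size_nseq. Qed.

Lemma size_word n k M (a : 'I_n.+1) :
  size (word k.+1 M a) = (M * (k.+1 * n.+1 ^ k.+1))%N.
Proof.
have le : (n.+1 <= n.+1 ^ k.+1)%N by rewrite expnS leq_pmulr // expn_gt0.
rewrite size_cat !size_flatten /shape map_nseq sumn_nseq -map_comp sumnE big_map.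
rewrite big_enum /=; under eq_bigr do rewrite size_run.
rewrite sum_nat_const card_ord size_flatten_digits size_iota.
by rewrite mulnA mulnAC -mulnDl; nia.
Qed.

(** * Block counts in sequences *)

Lemma mkseq_add (T : Type) (f : nat -> T) m l :
  mkseq f (m + l) = mkseq f m ++ mkseq (fun t => f (m + t)%N) l.
Proof.
rewrite /mkseq iotaD map_cat; congr (_ ++ _).
by rewrite -{1}[(0 + m)%N]addn0 iotaDl -map_comp; apply: eq_map.
Qed.

Lemma occS n k (a : nat -> 'I_n.+1) (b : k.-tuple 'I_n.+1) m :
  occ a b m.+1 = ((mkseq a k == b) + occ (fun t => a t.+1) b m)%N.
Proof.
rewrite /occ /= -[1%N]/(1 + 0)%N iotaDl count_map; congr addn.
congr nat_of_bool; apply/forallP/eqP => h.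
  apply: (@eq_from_nth _ ord0); rewrite size_mkseq ?size_tuple // => i ik.
  by rewrite nth_mkseq // -(tnth_nth _ _ (Ordinal ik)) -(eqP (h (Ordinal ik))).
move=> i; rewrite (tnth_nth ord0) -h nth_mkseq //; exact: ltn_ord.
Qed.

Lemma occ_block_count n k (a : nat -> 'I_n.+1) (b : k.-tuple 'I_n.+1) m l :
  (k.-1 <= l)%N ->
  occ a b m = block_count b (mkseq a m) (mkseq (fun t => a (m + t)%N) l).
Proof.
move=> kl; elim: m a => [//|m IH] a.
have h : take k (mkseq a m.+1 ++ mkseq (fun t => a (m.+1 + t)%N) l) = mkseq a k.
  by rewrite -mkseq_add /mkseq -map_take take_iota (minn_idPl _) //; lia.
rewrite occS IH -h; have -> := mkseq_add a 1 m.
by rewrite [in RHS]/= size_tuple.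
Qed.

Lemma occ_add n k (a : nat -> 'I_n.+1) (b : k.-tuple 'I_n.+1) m r :
  (occ a b m <= occ a b (m + r) <= occ a b m + r)%N.
Proof.
rewrite /occ iotaD count_cat leq_addr leq_add2l /=.
by apply: leq_trans (count_size _ _) _; rewrite size_iota.
Qed.

(** Counts within a bounded distance of m / (n+1)^k, multiplied out to stay in [nat]; this survives
    the prefixing of a digit and implies simple normality. *)
Definition bounded_discrepancy n k (a : nat -> 'I_n.+1) :=
  exists C, forall (b : k.-tuple 'I_n.+1) m,
    (occ a b m * n.+1 ^ k <= m + C)%N /\ (m <= occ a b m * n.+1 ^ k + C)%N.

Definition scons (T : Type) (x : T) (a : nat -> T) t :=
  if t is t'.+1 then a t' else x.

Lemma bounded_discrepancy_scons n k i (a : nat -> 'I_n.+1) :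
  bounded_discrepancy k a -> bounded_discrepancy k (scons i a).
Proof.
case=> C h; exists (C + n.+1 ^ k)%N => b [|m]; first by rewrite /occ /=; lia.
rewrite occS -[(fun t => _)]/a; have [] := h b m.
have : (0 < n.+1 ^ k)%N by rewrite expn_gt0.
by case: (_ == _); rewrite !mulnDl; lia.
Qed.

Definition blocks n (w : 'I_n.+1 -> seq 'I_n.+1) L (s : nat -> 'I_n.+1) t :=
  nth ord0 (w (s (t %/ L))) (t %% L).

Lemma blocks_shift n (w : 'I_n.+1 -> seq 'I_n.+1) L s j : (0 < L)%N ->
  (forall a, size (w a) = L) ->
  mkseq (fun t => blocks w L s (j * L + t)) L = w (s j).
Proof.
move=> L0 sw; apply: (@eq_from_nth _ ord0); rewrite size_mkseq ?sw // => i iL.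
by rewrite nth_mkseq // /blocks divnMDl // modnMDl divn_small // addn0 modn_small.
Qed.

Lemma mkseq_blocks n (w : 'I_n.+1 -> seq 'I_n.+1) L s j : (0 < L)%N ->
  (forall a, size (w a) = L) ->
  mkseq (blocks w L s) (j * L) = flatten [seq w (s i) | i <- iota 0 j].
Proof.
move=> L0 sw; elim: j => [//|j IH].
rewrite mulSn addnC mkseq_add blocks_shift // IH -[j.+1]addn1 iotaD map_cat.
by rewrite flatten_cat /= cats0.
Qed.

(** At multiples of [L] the count is exactly [B] per word, as each word returns to k-1 zeros; in
    between it grows by at most [L], whence the constant. *)
Lemma bounded_discrepancy_blocks n k (w : 'I_n.+1 -> seq 'I_n.+1) L B s :
  (k.-1 <= L)%N -> (0 < L)%N -> (forall a, size (w a) = L) ->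
  (forall a, returns (nseq k.-1 ord0) (w a)) ->
  (forall (b : k.-tuple 'I_n.+1) a, block_count b (w a) (nseq k.-1 ord0) = B) ->
  (B * n.+1 ^ k = L)%N -> bounded_discrepancy k (blocks w L s).
Proof.
move=> kL L0 sw rw cw BL; exists (L * n.+1 ^ k)%N => b m.
have occE j : occ (blocks w L s) b (j * L) = (j * B)%N.
  rewrite (occ_block_count _ _ _ kL) blocks_shift // mkseq_blocks //.
  rewrite (@block_count_ext _ _ _ _ (nseq k.-1 ord0)); last first.
    rewrite size_tuple [RHS]take_oversize ?size_nseq //.
    by have /eqP := rw (s j); rewrite size_nseq takel_cat // sw.
  rewrite block_count_flatten ?size_nseq ?size_tuple //; last first.
    by apply/allP => x /mapP[i _ ->].
  rewrite -map_comp sumnE big_map.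
  under eq_bigr => i _ do rewrite /= cw.
  by rewrite big_const_seq count_predT size_iota iter_addn_0 mulnC.
have := @occ_add _ _ (blocks w L s) b ((m %/ L) * L) (m %% L).
rewrite -divn_eq occE; have := ltn_pmod m L0; have := divn_eq m L.
have : (0 < n.+1 ^ k)%N by rewrite expn_gt0.
move: (n.+1 ^ k)%N BL (occ _ _ _) (m %/ L)%N (m %% L)%N => q <- o d r q0 -> r_lt /andP[h1 h2].
by split; nia.
Qed.

Local Open Scope classical_set_scope.
Local Open Scope ring_scope.

(** * Codings of weights *)

(** Indices are peeled off one after another by choice, never leaving [P]. This serves both for
    weights in the simplex and for points of the attractor. *)
Lemma exists_orbit (I T : Type) (P : T -> Prop) (S : I -> T -> T) :
  (forall y, P y -> exists i y', P y' /\ y = S i y') ->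
  forall y, P y ->
  exists a : nat -> I, forall m, exists y', P y' /\ y = foldr S y' (mkseq a m).
Proof.
move=> step y Py.
have ex (z : {y | P y}) : exists iz : I * {y | P y}, sval z = S iz.1 (sval iz.2).
  case: z => z Pz; have [i [y' [Py' zE]]] := step z Pz.
  by exists (i, exist _ y' Py').
have [f fE] := choice ex.
pose st m := iter m (fun z => (f z).2) (exist _ y Py).
exists (fun m => (f (st m)).1) => m; exists (sval (st m)); split; first exact: svalP.
elim: m => [//|m IH]; rewrite mkseqS foldr_rcons {1}IH; congr foldr.
by rewrite fE.
Qed.

Lemma sum_ge_exists (R : realDomainType) n (f : 'I_n.+1 -> R) e :
  n.+1%:R * e <= \sum_i f i -> exists i, e <= f i.
Proof.
move=> h; apply/existsP; apply: contraLR h; rewrite negb_exists => /forallP h.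
rewrite -ltNge mulr_natl -[n.+1 in ltRHS]card_ord -sumr_const.
apply: ltr_sum => [|i _]; last by rewrite ltNge h.
by have := mem_index_enum (ord0 : 'I_n.+1); case: (index_enum _).
Qed.

Definition Sword (R : realType) d n (lam : R) (p : 'I_n.+1 -> 'rV[R]_d)
  (w : seq 'I_n.+1) (x : 'rV[R]_d) := foldr (Smap lam p) x w.

Definition vtx (R : realType) n (i : 'I_n.+1) : 'rV[R]_n.+1 := delta_mx 0 i.

Definition simplex (R : realType) n (c : 'rV[R]_n.+1) :=
  (forall i, 0 <= c 0 i) /\ \sum_i c 0 i = 1.

(** With the points as rows, [c *m mix p] is the barycentre with weights [c]. *)
Definition mix (R : realType) d n (p : 'I_n.+1 -> 'rV[R]_d) : 'M[R]_(n.+1, d) :=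
  \matrix_i p i.

Lemma vtxE (R : realType) n (i j : 'I_n.+1) : vtx R i 0 j = (i == j)%:R.
Proof. by rewrite mxE eqxx /= eq_sym. Qed.

Lemma vtx_mix (R : realType) d n (p : 'I_n.+1 -> 'rV[R]_d) i : vtx R i *m mix p = p i.
Proof. by rewrite -rowE rowK. Qed.

Lemma mix_sum (R : realType) d n (p : 'I_n.+1 -> 'rV[R]_d) c :
  c *m mix p = \sum_i c 0 i *: p i.
Proof. by rewrite mulmx_sum_row; apply: eq_bigr => i _; rewrite rowK. Qed.

Lemma ScompE (R : realType) d n (lam : R) (p : 'I_n.+1 -> 'rV[R]_d) a j x :
  Scomp lam p a j x = Sword lam p (mkseq a j) x.
Proof. by rewrite /Sword /mkseq foldr_map. Qed.

Lemma Sword_cat (R : realType) d n (lam : R) (p : 'I_n.+1 -> 'rV[R]_d) w1 w2 x :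
  Sword lam p (w1 ++ w2) x = Sword lam p w1 (Sword lam p w2 x).
Proof. exact: foldr_cat. Qed.

Lemma Sword_affine (R : realType) d n (lam : R) (p : 'I_n.+1 -> 'rV[R]_d) w x :
  Sword lam p w x = lam ^+ size w *: x + Sword lam p w 0.
Proof.
elim: w => [|i w IH] /=; first by rewrite expr0 scale1r addr0.
by rewrite IH /Smap scalerDr scalerA -exprS -addrA.
Qed.

(** Taking barycentres is linear and sends [vtx R i] to [p i]; codings can therefore be built on
    weights alone. *)
Lemma Smap_mix (R : realType) d n (lam : R) (p : 'I_n.+1 -> 'rV[R]_d) i c :
  Smap lam p i (c *m mix p) = Smap lam (@vtx R n) i c *m mix p.
Proof. by rewrite /Smap mulmxDl -!scalemxAl vtx_mix. Qed.

Lemma Sword_mix (R : realType) d n (lam : R) (p : 'I_n.+1 -> 'rV[R]_d) w c :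
  Sword lam p w (c *m mix p) = Sword lam (@vtx R n) w c *m mix p.
Proof. by elim: w => //= i w ->; rewrite Smap_mix. Qed.

Lemma Smap_vtxE (R : realType) n (lam : R) i (c : 'rV[R]_n.+1) j :
  Smap lam (@vtx R n) i c 0 j = lam * c 0 j + (1 - lam) * (i == j)%:R.
Proof. by rewrite 3!mxE vtxE. Qed.

Lemma sum_Smap_vtx (R : realType) n (lam : R) i (c : 'rV[R]_n.+1) :
  \sum_j Smap lam (@vtx R n) i c 0 j = lam * (\sum_j c 0 j) + (1 - lam).
Proof.
under eq_bigr => j _ do rewrite Smap_vtxE.
rewrite big_split /= -!mulr_sumr (_ : \sum_j (i == j)%:R = 1) ?mulr1 //.
by rewrite (bigD1 i) //= eqxx big1 ?addr0 // => j; rewrite eq_sym => /negPf ->.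
Qed.

Lemma simplex_Smap (R : realType) n (lam : R) i (c : 'rV[R]_n.+1) :
  0 <= lam <= 1 -> simplex c -> simplex (Smap lam (@vtx R n) i c).
Proof.
move=> /andP[l0 l1] [c0 c1]; split=> [j|]; last by rewrite sum_Smap_vtx c1; ring.
by rewrite Smap_vtxE addr_ge0 ?mulr_ge0 ?subr_ge0.
Qed.

Lemma simplex_Sword (R : realType) n (lam : R) w (c : 'rV[R]_n.+1) :
  0 <= lam <= 1 -> simplex c -> simplex (Sword lam (@vtx R n) w c).
Proof. by move=> l01 sc; elim: w => //= i w; apply: simplex_Smap. Qed.

Lemma simplex_mulmx (R : realType) n (t : 'I_n.+1 -> 'rV[R]_n.+1) c :
  (forall a, simplex (t a)) -> simplex c -> simplex (c *m mix t).
Proof.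
move=> st [c0 c1]; rewrite mix_sum; split=> [i|].
  by rewrite summxE; apply: sumr_ge0 => a _; rewrite mxE mulr_ge0 //; case: (st a).
under eq_bigr do rewrite summxE.
rewrite exchange_big /= -[RHS]c1; apply: eq_bigr => a _.
by under eq_bigr do rewrite mxE; rewrite -mulr_sumr (st a).2 mulr1.
Qed.

Lemma Smap_vtx_inv (R : realType) n (lam : R) i (c : 'rV[R]_n.+1) :
  0 < lam -> \sum_j c 0 j = 1 ->
  exists c' : 'rV[R]_n.+1, [/\ c = Smap lam (@vtx R n) i c', \sum_j c' 0 j = 1
    & forall j, lam * c' 0 j = c 0 j - (1 - lam) * (i == j)%:R].
Proof.
move=> l0 c1; pose c' := lam^-1 *: (c - (1 - lam) *: vtx R i); exists c'.
have lu : lam \is a GRing.unit by rewrite unitfE gt_eqF.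
have cE : c = Smap lam (@vtx R n) i c' by rewrite /Smap scalerA divrr // scale1r subrK.
split=> // [|j]; last by rewrite cE Smap_vtxE addrK.
apply: (mulrI lu); apply: (addIr (1 - lam)); rewrite -(sum_Smap_vtx lam i) -cE c1; ring.
Qed.

(** Some weight is at least 1/(n+1), hence at least [1 - rho], and can be peeled off. Used with
    ratio [lam] for letters and [lam ^+ L] for whole words. *)
Lemma simplex_split (R : realType) n (rho : R) (s : 'rV[R]_n.+1) :
  0 < rho -> n.+1%:R * (1 - rho) <= 1 -> simplex s ->
  exists a s', simplex s' /\ s = Smap rho (@vtx R n) a s'.
Proof.
move=> r0 r1 [s0 s1]; have [a ha] : exists a, 1 - rho <= s 0 a.
  by apply: sum_ge_exists; rewrite s1.
have [s' [sE s'1 s'E]] := Smap_vtx_inv a r0 s1.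
exists a, s'; split=> //; split=> // j.
rewrite -(pmulr_rge0 _ r0) s'E; case: eqP => [<-|_]; last by rewrite mulr0 subr0.
by rewrite mulr1 subr_ge0.
Qed.

(* By [bounded_discrepancy_normal] and [normal_coded_coding], [c *m mix p] then
   has a [k]-simply normal coding, whatever the points [p]. *)
Definition normal_coded (R : realType) n k (lam : R) (c : 'rV[R]_n.+1) :=
  exists a : nat -> 'I_n.+1, bounded_discrepancy k a /\
    forall m, exists c', simplex c' /\ c = Sword lam (@vtx R n) (mkseq a m) c'.

Lemma normal_coded_Smap (R : realType) n k (lam : R) i (c : 'rV[R]_n.+1) :
  0 <= lam <= 1 -> normal_coded k lam c -> normal_coded k lam (Smap lam (@vtx R n) i c).
Proof.
move=> l01 [a [da ha]]; exists (scons i a); split.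
  exact: bounded_discrepancy_scons.
case=> [|m].
  have [c' [sc ->]] := ha 0%N; exists (Smap lam (@vtx R n) i c').
  by split=> //; exact: simplex_Smap.
have [c' [sc ->]] := ha m; exists c'; split=> //.
by rewrite (mkseq_add (scons i a) 1 m).
Qed.

(** The map of the word [w a] is the contraction by [lam ^+ L] with fixed point [t a], so
    [simplex_split] at that ratio chooses one word after another. *)
Lemma normal_coded_blocks (R : realType) n k (lam : R)
    (w : 'I_n.+1 -> seq 'I_n.+1) L (t : 'I_n.+1 -> 'rV[R]_n.+1) s :
  0 <= lam <= 1 -> (0 < L)%N -> (forall a, size (w a) = L) ->
  (forall s, bounded_discrepancy k (blocks w L s)) ->
  (forall a, simplex (t a)) ->
  (forall a, Sword lam (@vtx R n) (w a) 0 = (1 - lam ^+ L) *: t a) ->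
  0 < lam ^+ L -> n.+1%:R * (1 - lam ^+ L) <= 1 ->
  simplex s -> normal_coded k lam (s *m mix t).
Proof.
move=> l01 L0 sw bd st wt r0 r1 ss.
have [g gE] := exists_orbit (fun s => @simplex_split R n _ s r0 r1) ss.
exists (blocks w L g); split=> // m.
have [s' [ss' sE]] := gE m.
have blockE y : Sword (lam ^+ L) t (mkseq g m) y
    = Sword lam (@vtx R n) (mkseq (blocks w L g) (m * L)) y.
  rewrite mkseq_blocks // /mkseq; elim: (iota 0 m) => //= j l ->.
  by rewrite Sword_cat [in RHS]Sword_affine sw wt.
(* The first [m] letters lie inside the first [m] words; the remaining letters are absorbed into the
   new weights. *)
have mL : (m * L = m + (m * L - m))%N by rewrite subnKC // leq_pmulr.
exists (Sword lam (@vtx R n)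
  (mkseq (fun j => blocks w L g (m + j)%N) (m * L - m)) (s' *m mix t)); split.
  by apply: simplex_Sword => //; exact: simplex_mulmx.
by rewrite -Sword_cat -mkseq_add -mL -blockE Sword_mix -[Sword _ _ _ s']/(foldr _ _ _) -sE.
Qed.

(** * Displacement of the fixed points [t_a] *)

Lemma Sword0_cat (R : realType) d n (lam : R) (p : 'I_n.+1 -> 'rV[R]_d) w1 w2 :
  Sword lam p (w1 ++ w2) 0 = lam ^+ size w1 *: Sword lam p w2 0 + Sword lam p w1 0.
Proof. by rewrite Sword_cat Sword_affine. Qed.

(** A letter at position j contributes [(1 - lam) * lam ^+ j] to the weight of its digit. In each
    copy of [r_i] only the last letter depends on [i]; the k zeros before it go into [kappa]. *)
Lemma Sword0_run (R : realType) n k M (lam : R) : exists kappa, forall i : 'I_n.+1,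
  Sword lam (@vtx R n) (run n k.+1 M i) 0
    = kappa + ((1 - lam) * lam ^+ k * \sum_(s < M) lam ^+ (k.+1 * s)) *: vtx R i.
Proof.
elim: M => [|M [kap IH]].
  by exists 0 => i; rewrite /run /= big_ord0 mulr0 scale0r addr0.
exists (lam ^+ k.+1 *: kap + Sword lam (@vtx R n) (nseq k ord0) 0) => i.
rewrite -[run n _ _ _]/(digits n k.+1 i ++ run n k.+1 M i) Sword0_cat size_digits IH.
have -> : digits n k.+1 i = nseq k ord0 ++ [:: i].
  rewrite -[k.+1]addn1 digits_small ?expn1 ?ltn_ord //; congr (_ ++ [:: _]).
  by apply: val_inj; rewrite /= modn_small.
rewrite Sword0_cat size_nseq /= /Smap scaler0 add0r big_ord_recl muln0 expr0.
under [in RHS]eq_bigr => s _ do rewrite lift0 mulnS exprD.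
rewrite -mulr_sumr; set S := \sum_(_ < _) _.
apply/rowP => j; rewrite !mxE; set x := Sword _ _ _ _ _ _; ring.
Qed.

Lemma Sword0_runs (R : realType) n k M (lam : R) l : exists kappa,
  forall t : seq 'I_n.+1, size t = l ->
  Sword lam (@vtx R n) (flatten [seq run n k.+1 M (i : 'I_n.+1) | i <- t]) 0
    = kappa + ((1 - lam) * lam ^+ k * \sum_(s < M) lam ^+ (k.+1 * s)) *:
        \sum_(j < l) lam ^+ (M * k.+1 * j) *: vtx R (nth ord0 t j).
Proof.
have [kap kapE] := Sword0_run n k M lam.
elim: l => [|l [kap' IH]].
  by exists 0 => -[] // _; rewrite big_ord0 scaler0 addr0.
exists (lam ^+ (M * k.+1) *: kap' + kap) => -[//|i t] [tl].
rewrite /= Sword0_cat size_run kapE IH //.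
set e := _ * (\sum_(_ < M) _); rewrite big_ord_recl muln0 expr0 scale1r.
under [in RHS]eq_bigr => s _ do rewrite lift0 mulnS exprD -scalerA.
rewrite -scaler_sumr; set S := \sum_(_ < l) _.
by apply/rowP => j; rewrite !mxE; ring.
Qed.

(** Exchanging the runs at places 0 and [a] swaps the factors 1 and [lam ^+ (M * k.+1 * a)] of the
    two vertices; all the rest cancels. *)
Lemma Sword0_word (R : realType) n k M (lam : R) (a : 'I_n.+1) :
  Sword lam (@vtx R n) (word k.+1 M a) 0
    = Sword lam (@vtx R n) (word k.+1 M ord0) 0
      + ((1 - lam) * lam ^+ k * (\sum_(s < M) lam ^+ (k.+1 * s))
         * (1 - lam ^+ (M * k.+1 * a))) *: (vtx R a - vtx R ord0).
Proof.
have [kap kapE] := Sword0_runs n k M lam n.+1.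
have wE b : Sword lam (@vtx R n)
   (flatten [seq run n k.+1 M (tperm ord0 b i) | i : 'I_n.+1]) 0
    = kap + ((1 - lam) * lam ^+ k * \sum_(s < M) lam ^+ (k.+1 * s)) *:
        \sum_(j < n.+1) lam ^+ (M * k.+1 * j) *: vtx R (tperm ord0 b j).
  rewrite /image_mem -[map _ _]/(map ((fun i : 'I_n.+1 => run n k.+1 M i) \o tperm ord0 b) _).
  rewrite map_comp kapE.
    congr (_ + _ *: _); apply: eq_bigr => j _.
    by rewrite (nth_map ord0) ?size_enum_ord // nth_ord_enum.
  by rewrite size_map size_enum_ord.
rewrite /word !Sword0_cat !wE /image_mem.
rewrite !size_flatten /shape -!map_comp.
rewrite (eq_map (g := size \o (fun i => run n k.+1 M (tperm ord0 ord0 i)))); last first.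
  by move=> i /=; rewrite !size_run.
set e := _ * (\sum_(_ < M) _).
rewrite -!addrA; congr (_ + (_ + _)); rewrite -[(e * _) *: _]scalerA -scalerDr; congr (_ *: _).
under [in RHS]eq_bigr do rewrite tperm1 perm1.
have [->|a0] := eqVneq a ord0.
  rewrite subrr scaler0 addr0; apply: eq_bigr => j _.
  by rewrite tperm1 perm1.
rewrite (bigD1 ord0) // (bigD1 a) //= tpermL tpermR.
rewrite [in RHS](bigD1 ord0) // [in RHS](bigD1 a) //=.
rewrite muln0 expr0 (eq_bigr (fun j : 'I_n.+1 => lam ^+ (M * k.+1 * j) *: vtx R j)); last first.
  by move=> j /andP[j0 ja]; rewrite tpermD // eq_sym.
set S := \sum_(_ < _ | _) _; apply/rowP => j; rewrite !mxE; ring.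
Qed.

Lemma Sword0_ge0 (R : realType) n (lam : R) (w : seq 'I_n.+1) i :
  0 <= lam <= 1 -> 0 <= Sword lam (@vtx R n) w 0 0 i.
Proof.
move=> /andP[l0 l1]; elim: w => [|j w IH] /=; first by rewrite mxE.
by rewrite Smap_vtxE addr_ge0 ?mulr_ge0 ?subr_ge0.
Qed.

Lemma sum_Sword0 (R : realType) n (lam : R) (w : seq 'I_n.+1) :
  \sum_i Sword lam (@vtx R n) w 0 0 i = 1 - lam ^+ size w.
Proof.
elim: w => [|j w IH] /=; first by rewrite big1 ?subrr // => i _; rewrite mxE.
by rewrite sum_Smap_vtx IH exprS; ring.
Qed.

(** Away from 0 the coordinates of [s] must be [r i / tau i]. They are nonnegative and sum to at
    most 1, because these [r i] sum to at most [e] and each [tau i] is at least [e]. *)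
Lemma corner_simplex (R : realType) n (t : 'I_n.+1 -> 'rV[R]_n.+1)
    (tau : 'I_n.+1 -> R) (e : R) (c : 'rV[R]_n.+1) :
  0 < e -> (forall a, a != ord0 -> e <= tau a) ->
  (forall a, t a = t ord0 + tau a *: (vtx R a - vtx R ord0)) ->
  \sum_i t ord0 0 i = 1 -> \sum_i c 0 i = 1 ->
  (forall i, t ord0 0 i - (i == ord0)%:R * e <= c 0 i) ->
  exists s, simplex s /\ c = s *m mix t.
Proof.
move=> e0 taue tE t1 c1 hc.
pose r i := c 0 i - t ord0 0 i.
have tau0 a : a != ord0 -> 0 < tau a by move=> /taue; apply: lt_le_trans.
have r0 a : a != ord0 -> 0 <= r a.
  by move=> h; have := hc a; rewrite (negPf h) mul0r subr0 /r subr_ge0.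
have sr : r ord0 = - \sum_(i | i != ord0) r i.
  apply/eqP; rewrite -addr_eq0; apply/eqP.
  have : \sum_i r i = 0 by rewrite sumrB c1 t1 subrr.
  by rewrite (bigD1 ord0).
pose q := \sum_(i | i != ord0) r i / tau i.
pose s : 'rV[R]_n.+1 := \row_i (if i == ord0 then 1 - q else r i / tau i).
have sq : \sum_i s 0 i = 1.
  rewrite (bigD1 ord0) //= mxE eqxx (eq_bigr (fun i => r i / tau i)) ?subrK //.
  by move=> i h; rewrite mxE (negPf h).
have q1 : q <= 1.
  rewrite -(ler_pM2l e0) mulr1; apply: (@le_trans _ _ (- r ord0)); last first.
    by have := hc ord0; rewrite eqxx mul1r /r; lra.
  rewrite sr opprK mulr_sumr; apply: ler_sum => i h.
  rewrite mulrA ler_pdivrMr ?tau0 // mulrC ler_wpM2l ?r0 ?taue //.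
exists s; split.
  split=> // i; rewrite mxE; case: eqP => [_|/eqP h]; first by rewrite subr_ge0.
  by rewrite divr_ge0 ?r0 // ltW // tau0.
have sE : s *m mix t = t ord0 + \sum_(a | a != ord0) r a *: (vtx R a - vtx R ord0).
  rewrite mix_sum (eq_bigr (fun a => s 0 a *: t ord0 + (s 0 a * tau a) *: (vtx R a - vtx R ord0))).
    rewrite big_split /= -scaler_suml sq scale1r; congr (_ + _).
    rewrite (bigD1 ord0) //= subrr scaler0 add0r; apply: eq_bigr => a h.
    by rewrite mxE (negPf h) divfK // gt_eqF // tau0.
  by move=> a _; rewrite {1}tE scalerDr scalerA.
rewrite sE; apply/rowP => j; rewrite mxE summxE.
under eq_bigr => a _ do rewrite 2!mxE [X in _ * (_ + X)]mxE !vtxE.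
have [->|j0] := eqVneq j ord0.
  rewrite (eq_bigr (fun a => - r a)); last first.
    by move=> a /negPf ->; rewrite sub0r mulrN1.
  by rewrite sumrN -sr /r; ring.
rewrite (bigD1 j) //= eqxx big1 ?addr0 /r; first by rewrite subr0 mulr1 addrC subrK.
by move=> a /andP[a0 aj]; rewrite (negPf aj) subr0 mulr0.
Qed.

(** * Estimates for ratios close to 1 *)

Lemma bernoulli_le (R : realType) (lam : R) j : 0 <= lam <= 1 ->
  1 - lam ^+ j <= j%:R * (1 - lam).
Proof.
move=> /andP[l0 l1]; elim: j => [|j IH]; first by rewrite expr0 mul0r subrr.
have : 0 <= (1 - lam ^+ j) * (1 - lam) by rewrite mulr_ge0 ?subr_ge0 ?exprn_ile1.
by rewrite exprS -natr1; lra.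
Qed.

Lemma one_subX_ge (R : realType) (lam : R) j : 0 <= lam <= 1 ->
  (1 - lam) * (j%:R * lam ^+ j) <= 1 - lam ^+ j.
Proof.
move=> /andP[l0 l1]; elim: j => [|j IH]; first by rewrite expr0 mul0r mulr0 subrr.
have h1 : 0 <= (1 - lam) * (1 - lam ^+ j.+1).
  by rewrite mulr_ge0 ?subr_ge0 ?exprn_ile1.
by have := ler_wpM2l l0 IH; rewrite exprS in h1 *; rewrite -natr1; lra.
Qed.

Lemma exp_small (R : realType) (lam x : R) : 0 <= lam < 1 -> 0 < x ->
  exists m, lam ^+ m <= x.
Proof.
move=> /andP[l0 l1] x0.
have : (fun m => lam ^+ m) @ \oo --> (0 : R) by apply: cvg_expr; rewrite ger0_norm.
move=> /cvgrPdist_le /(_ x x0) [m _ /(_ m (leqnn m))] /=.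
by rewrite sub0r normrN ger0_norm ?exprn_ge0 // => h; exists m.
Qed.

(* The left factor on the right-hand side, coming from the [M] copies in a run,
   is about [M * (1 - lam)] and the last one at least about
   [M * k.+1 * (1 - lam)]: their product is quadratic in [M], whereas [L] is
   linear in [M]. *)
Lemma displacement_ge (R : realType) (lam : R) q k Q M L a :
  0 <= lam <= 1 -> (0 < q)%N -> (0 < Q)%N -> (0 < a)%N ->
  M = (2 * (q * Q))%N -> L = (M * (k.+1 * Q))%N ->
  (4 * (q * L))%:R * (1 - lam) <= 1 ->
  q%:R * (1 - lam) * (1 - lam ^+ L)
  <= (1 - lam) * lam ^+ k * (\sum_(s < M) lam ^+ (k.+1 * s))
     * (1 - lam ^+ (M * k.+1 * a)).
Proof.
move=> l01 q0 Q0 a0 ME LE small; have /andP[l0 l1] := l01.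
set e := 1 - lam in small *; have e0 : 0 <= e by rewrite subr_ge0.
pose B := (M * k.+1)%N; set x := lam ^+ B.
have x0 : 0 <= x by apply: exprn_ge0.
have BL : (B <= L)%N by rewrite LE mulnA leq_pmulr.
(* By [small], [1 - lam ^+ (2 * B)] is at most [2 * B * (1 - lam)], hence at most 1/2. *)
have half : 1 / 2 <= x * x.
  rewrite -exprD addnn -mul2n.
  have := bernoulli_le (2 * B) l01; rewrite -/e => h.
  have : (2 * (2 * B))%:R * e <= (4 * (q * L))%:R * e.
    by rewrite ler_wpM2r // ler_nat; nia.
  by rewrite natrM -mulrA => h2; lra.
have h1 : M%:R * x <= lam ^+ k * \sum_(s < M) lam ^+ (k.+1 * s).
  rewrite mulr_sumr -[M in M%:R]card_ord mulr_natl -sumr_const; apply: ler_sum => s _.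
  by rewrite -exprD ler_wiXn2l // /B; have := ltn_ord s; nia.
have h2 : e * (B%:R * x) <= 1 - lam ^+ (M * k.+1 * a).
  apply: le_trans (one_subX_ge B l01) _.
  by rewrite lerB // ler_wiXn2l // -/B leq_pmulr.
have h3 := bernoulli_le L l01; rewrite -/e in h3.
apply: (@le_trans _ _ (q%:R * e * (L%:R * e))).
  by apply: ler_wpM2l => //; rewrite mulr_ge0.
rewrite -(mulrA e) -!(mulrA e).
apply: (@le_trans _ _ (e * ((M%:R * x) * (e * (B%:R * x))))); last first.
  apply: ler_wpM2l => //; apply: ler_pM => //; by rewrite !mulr_ge0.
(* The value of [M] is chosen for this identity; the factor 1/2 is paid for by [half]. *)
have LB : (q * L)%:R = M%:R * B%:R / 2 :> R.
  apply: (@mulIf _ 2) => //; rewrite divfK // -!natrM; congr _%:R.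
  by rewrite LE /B ME; nia.
rewrite [leLHS](_ : _ = e * e * (q * L)%:R); last by rewrite natrM; ring.
rewrite [leRHS](_ : _ = e * e * (M%:R * B%:R * (x * x))); last by ring.
apply: ler_wpM2l; first exact: mulr_ge0.
by rewrite LB ler_wpM2l ?mulr_ge0 //; lra.
Qed.

(** * From positive weights to the corner region *)

Lemma simplex_le1 (R : realType) n (c : 'rV[R]_n.+1) i : simplex c -> c 0 i <= 1.
Proof. by case=> c0 <-; rewrite (bigD1 i) //= lerDl sumr_ge0. Qed.

Lemma steering (R : realType) n k (lam : R) (b : 'rV[R]_n.+1) :
  0 < lam <= 1 ->
  \sum_i b 0 i <= 1 - n.+1%:R * (1 - lam) -> 0 <= \sum_i b 0 i ->
  (forall c : 'rV[R]_n.+1, \sum_i c 0 i = 1 -> (forall i, b 0 i <= c 0 i) ->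
    normal_coded k lam c) ->
  forall m (c : 'rV[R]_n.+1), \sum_i c 0 i = 1 -> (forall i, lam ^+ m * b 0 i <= c 0 i) ->
  normal_coded k lam c.
Proof.
move=> /andP[l0 l1] bs b0 base; elim=> [|m IH] c c1 hc.
  by apply: base => // i; have := hc i; rewrite expr0 mul1r.
(* As [b] has nonnegative sum and [lam ^+ m.+1] is at most 1, these differences sum to at least
   [1 - \sum_i b 0 i], hence to at least (n+1)(1 - lam). *)
have [i hi] : exists i, 1 - lam <= c 0 i - lam ^+ m.+1 * b 0 i.
  apply: sum_ge_exists; rewrite sumrB -mulr_sumr c1.
  have := exprn_ile1 m.+1 (ltW l0) l1; set x := _ ^+ _ => h.
  have : x * (\sum_j b 0 j) <= \sum_j b 0 j by rewrite ler_piMl.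
  lra.
have [c' [cE c'1 c'E]] := Smap_vtx_inv i l0 c1.
rewrite cE; apply: normal_coded_Smap; first by rewrite l1 ltW.
apply: IH => // j; rewrite -(ler_pM2l l0) mulrA -exprS c'E.
case: eqP => [<-|_]; last by rewrite mulr0 subr0; apply: hc.
by rewrite mulr1 lerBrDr addrC -lerBrDr.
Qed.

Lemma normal_coded_positive (R : realType) n k : (0 < k)%N ->
  exists delta : R, [/\ 0 < delta, n.+1%:R * delta <= 1 &
    forall lam, 0 < lam -> 1 - delta < lam -> lam < 1 ->
    forall c : 'rV[R]_n.+1, (forall i, 0 < c 0 i) -> \sum_i c 0 i = 1 ->
    normal_coded k lam c].
Proof.
move=> k0; pose q := n.+1; pose Q := (q ^ k.+1)%N.
pose M := (2 * (q * Q))%N; pose L := (M * (k.+1 * Q))%N.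
have Q0 : (0 < Q)%N by rewrite expn_gt0.
have M0 : (0 < M)%N by rewrite !muln_gt0.
have L0 : (0 < L)%N by rewrite muln_gt0 M0 muln_gt0 Q0.
have qL0 : 0 < (4 * (q * L))%:R :> R by rewrite ltr0n 2!muln_gt0 L0.
(* This yields the bound [small], which [displacement_ge] asks for and which also gives [rhoq] and
   [e1]. *)
exists (4 * (q * L))%:R^-1; split=> [||lam l0 ld l1 c c0 c1].
- by rewrite invr_gt0.
- by rewrite ler_pdivrMr // mul1r ler_nat; nia.
have small : (4 * (q * L))%:R * (1 - lam) <= 1.
  by rewrite -ler_pdivlMl // mulr1; lra.
have l01 : 0 <= lam <= 1 by rewrite !ltW.
pose rho := lam ^+ L.
have rho1 : rho < 1 by rewrite exprn_ilt1 ?ltW // -lt0n.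
have rho0 : 0 < rho by apply: exprn_gt0.
have rhoq : q%:R * (1 - rho) <= 1.
  apply: le_trans small; apply: (@le_trans _ _ (q%:R * (L%:R * (1 - lam)))).
    by rewrite ler_wpM2l // bernoulli_le.
  by rewrite mulrA -natrM ler_wpM2r ?subr_ge0 ?(ltW l1) // ler_nat leq_pmull.
pose w (a : 'I_n.+1) := word k.+1 M a.
have sw a : size (w a) = L by exact: size_word.
pose t a := (1 - rho)^-1 *: Sword lam (@vtx R n) (w a) 0.
have rhoN0 : 1 - rho != 0 by rewrite subr_eq0 gt_eqF.
have wt a : Sword lam (@vtx R n) (w a) 0 = (1 - rho) *: t a.
  by rewrite /t scalerA divff // scale1r.
have st a : simplex (t a).
  split=> [i|]; first by rewrite mxE mulr_ge0 ?Sword0_ge0 // invr_ge0 subr_ge0 ltW.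
  by under eq_bigr do rewrite mxE; rewrite -mulr_sumr sum_Sword0 sw mulVf.
have bd s : bounded_discrepancy k (blocks w L s).
  apply: (@bounded_discrepancy_blocks _ _ _ _ (M * (k.+1 * n.+1))) => //.
  - by apply: leq_trans (leq_pmull _ M0); apply: leq_trans (leq_pmulr _ Q0); lia.
  - by move=> a; exact: returns_word.
  - by move=> b a; exact: block_count_word.
  - by rewrite /L /Q /q expnS !mulnA.
pose tau (a : 'I_n.+1) := (1 - rho)^-1 * ((1 - lam) * lam ^+ k
   * (\sum_(s < M) lam ^+ (k.+1 * s)) * (1 - lam ^+ (M * k.+1 * a))).
have tE a : t a = t ord0 + tau a *: (vtx R a - vtx R ord0).
  by rewrite /t {1}/w Sword0_word scalerDr scalerA.
pose e := q%:R * (1 - lam).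
have e0 : 0 < e by rewrite mulr_gt0 ?subr_gt0 // ltr0n.
have taue a : a != ord0 -> e <= tau a.
  move=> a0; rewrite /tau ler_pdivlMl ?subr_gt0 // mulrC.
  by apply: (displacement_ge (Q := Q)) => //; rewrite lt0n.
pose b := t ord0 - e *: vtx R ord0.
have bE i : b 0 i = t ord0 0 i - (i == ord0)%:R * e.
  by rewrite mxE [X in _ + X]mxE [X in - X]mxE vtxE eq_sym mulrC.
have bs : \sum_i b 0 i = 1 - e.
  under eq_bigr do rewrite bE.
  rewrite sumrB (st ord0).2 -mulr_suml (bigD1 ord0) //= big1 ?addr0 ?mul1r //.
  by move=> i /negPf ->.
have e1 : e <= 1.
  apply: le_trans small; rewrite ler_wpM2r ?subr_ge0 ?(ltW l1) //.
  by rewrite ler_nat mulnCA leq_pmulr // muln_gt0.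
(* Since [b] is at most [t ord0], whose weights are at most 1, it suffices that [lam ^+ m] is at
   most the least weight of [c]. *)
have [m hm] : exists m, forall i, lam ^+ m * b 0 i <= c 0 i.
  pose x := \big[Num.min/1]_i c 0 i.
  have x0 : 0 < x by apply: lt_bigmin => // i _.
  have [m lm] : exists m, lam ^+ m <= x by apply: exp_small; rewrite // ltW.
  exists m => i; apply: le_trans (_ : x <= _); last exact: bigmin_le.
  apply: le_trans lm; rewrite ler_piMr ?exprn_ge0 ?(ltW l0) // bE.
  rewrite lerBlDr; apply: le_trans (simplex_le1 i (st ord0)) _.
  by rewrite lerDl mulr_ge0 // ltW.
apply: (@steering _ _ _ _ b _ _ _ _ m) => //.
- by rewrite l0 ltW.
- by rewrite bs.
- by rewrite bs subr_ge0.
move=> c' c'1 hc'.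
have [|s [ss ->]] := corner_simplex e0 taue tE (st ord0).2 c'1.
  by move=> i; rewrite -bE.
exact: (normal_coded_blocks l01 L0 sw bd st wt rho0 rhoq ss).
Qed.

(** * Codings of points and the attractor *)

Lemma bounded_discrepancy_normal (R : realType) n k (a : nat -> 'I_n.+1) :
  bounded_discrepancy k a -> simply_normal R k a.
Proof.
move=> [C h] b; set q := (n.+1 ^ k)%N.
have q0 : 0 < q%:R :> R by rewrite ltr0n expn_gt0.
apply/cvgrPdist_le => e e0; near=> m.
have m0 : 0 < m%:R :> R by rewrite ltr0n; near: m; exact: nbhs_infty_gt.
have [h1 h2] := h b m.
have hC : C%:R / e <= m%:R by near: m; exact: nbhs_infty_ger.
rewrite ler_pdivrMr // in hC.
have q1 : 1 <= q%:R :> R by rewrite ler1n expn_gt0.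
have -> : q%:R^-1 - (occ a b m)%:R / m%:R
    = (m%:R - (occ a b m)%:R * q%:R) / (m%:R * q%:R) :> R.
  by field; rewrite !gt_eqF.
rewrite normrM normfV (gtr0_norm (mulr_gt0 m0 q0)) ler_pdivrMr ?mulr_gt0 //.
apply: (@le_trans _ _ C%:R).
  have r1 : (occ a b m)%:R * q%:R <= m%:R + C%:R :> R.
    by rewrite -natrM -natrD ler_nat.
  have r2 : m%:R <= (occ a b m)%:R * q%:R + C%:R :> R.
    by rewrite -natrM -natrD ler_nat.
  by rewrite ler_norml; apply/andP; split; lra.
apply: le_trans hC _; rewrite mulrC mulrA ler_peMr // ?mulr_ge0 // ltW //.
Unshelve. all: by end_near.
Qed.

(** Were [i] absent, the block of k letters [i] would have frequency 0. *)
Lemma simply_normal_occurs (R : realType) n k (a : nat -> 'I_n.+1) i :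
  (0 < k)%N -> simply_normal R k a -> exists t, a t = i.
Proof.
move=> k0 /(_ [tuple of nseq k i]) h; apply: contrapT => /forallNP ai.
have occ0 m : occ a [tuple of nseq k i] m = 0%N.
  apply/eqP; rewrite -leqn0 leqNgt -has_count; apply/hasPn => j _.
  apply/forallPn; exists (Ordinal k0); apply/eqP.
  by rewrite (tnth_nth i) /= nth_nseq k0; exact: ai.
have : (fun m => (occ a [tuple of nseq k i] m)%:R / (m%:R : R)) @ \oo --> (0 : R).
  by under eq_fun do rewrite occ0 mul0r; exact: cvg_cst.
move=> /(cvg_unique (@Rhausdorff R) h)/eqP.
by rewrite invr_eq0 pnatr_eq0 expn_eq0.
Qed.

Lemma cvg_expM0 (R : realType) (lam C : R) : 0 <= lam < 1 ->
  (fun m => lam ^+ m * C) @ \oo --> (0 : R).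
Proof.
move=> /andP[l0 l1]; rewrite -[X in _ --> X](mul0r C).
by apply: cvgMr_tmp; apply: cvg_expr; rewrite ger0_norm.
Qed.

(** The [m]-th approximation differs from [x] by [lam ^+ m *: y] with [y] bounded. *)
Lemma coding_of_bounded (R : realType) d n (lam : R) (p : 'I_n.+1 -> 'rV[R]_d) a x C :
  0 <= lam < 1 ->
  (forall m, exists y, `|y| <= C /\ x = Sword lam p (mkseq a m) y) ->
  is_coding lam p a x.
Proof.
move=> l01 h; apply/cvgrPdist_le => e e0; near=> m.
have [y [yC ->]] := h m; have /andP[l0 _] := l01.
rewrite ScompE Sword_affine addrK size_mkseq normrZ normrX ger0_norm //.
apply: (@le_trans _ _ (lam ^+ m * C)); first by rewrite ler_wpM2l ?exprn_ge0.
suff : `|0 - lam ^+ m * C| <= e by rewrite sub0r normrN; apply: le_trans; exact: ler_norm.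
by near: m; move/cvgrPdist_le : (cvg_expM0 C l01); apply.
Unshelve. all: by end_near.
Qed.

Lemma simplex_norm (R : realType) d n (p : 'I_n.+1 -> 'rV[R]_d) c :
  simplex c -> `|c *m mix p| <= \sum_i `|p i|.
Proof.
move=> sc; rewrite mix_sum; apply: le_trans (ler_norm_sum _ _ _) _.
apply: ler_sum => i _; rewrite normrZ ler_piMl //.
by rewrite ger0_norm ?simplex_le1 //; case: sc.
Qed.

Lemma normal_coded_coding (R : realType) d n k (lam : R) (p : 'I_n.+1 -> 'rV[R]_d) c :
  0 <= lam < 1 -> normal_coded k lam c ->
  exists a, is_coding lam p a (c *m mix p) /\ simply_normal R k a.
Proof.
move=> l01 [a [bd h]]; exists a; split; last exact: bounded_discrepancy_normal.
apply: (coding_of_bounded (C := \sum_i `|p i|) l01) => m.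
have [c' [sc' ->]] := h m; exists (c' *m mix p); split; first exact: simplex_norm.
by rewrite Sword_mix.
Qed.

Lemma simplex_coding (R : realType) d n (lam : R) (p : 'I_n.+1 -> 'rV[R]_d) c :
  0 < lam < 1 -> n.+1%:R * (1 - lam) <= 1 -> simplex c ->
  exists a, is_coding lam p a (c *m mix p).
Proof.
move=> /andP[l0 l1] small sc.
have [a ha] := exists_orbit (fun s => @simplex_split R n _ s l0 small) sc.
exists a; apply: (coding_of_bounded (C := \sum_i `|p i|)); first by rewrite ltW.
move=> m; have [c' [sc' ->]] := ha m.
exists (c' *m mix p); split; first exact: simplex_norm.
by rewrite Sword_mix.
Qed.

Lemma coding_shift (R : realType) d n (lam : R) (p : 'I_n.+1 -> 'rV[R]_d) a x m :
  0 < lam -> is_coding lam p a x ->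
  exists y, x = Sword lam p (mkseq a m) y /\
    is_coding lam p (fun t => a (m + t)%N) y.
Proof.
move=> l0 h; have lm : lam ^+ m != 0 by rewrite expf_neq0 // gt_eqF.
exists (lam ^- m *: (x - Sword lam p (mkseq a m) 0)); split.
  by rewrite Sword_affine size_mkseq scalerA divff // scale1r subrK.
rewrite /is_coding.
have -> : (fun j => Scomp lam p (fun t => a (m + t)%N) j 0)
   = (fun j => lam ^- m *: (Scomp lam p a (j + m)%N 0 - Sword lam p (mkseq a m) 0)).
  apply/funext => j; rewrite !ScompE addnC mkseq_add Sword_cat [in RHS]Sword_affine.
  by rewrite addrK size_mkseq scalerA mulVf // scale1r.
apply: cvgZl_tmp; apply: cvgB; last exact: cvg_cst.
by rewrite (cvg_shiftn m (fun j => Scomp lam p a j 0)).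
Qed.

(** The weights coded by the prefixes increase in every coordinate and sum to [1 - lam ^+ m], so
    they converge to a point of the simplex. *)
Lemma coding_simplex (R : realType) d n (lam : R) (p : 'I_n.+1 -> 'rV[R]_d) a x :
  0 < lam < 1 -> is_coding lam p a x -> exists c, simplex c /\ x = c *m mix p.
Proof.
move=> /andP[l0 l1] h; pose u m := Sword lam (@vtx R n) (mkseq a m) 0.
have l01 : 0 <= lam <= 1 by rewrite !ltW.
have u_cvg i : cvgn (fun m => u m 0 i).
  apply: nondecreasing_is_cvgn.
    apply/nondecreasing_seqP => m; rewrite /u mkseqS -cats1 Sword0_cat.
    rewrite [leRHS]mxE [X in _ <= X + _]mxE lerDr mulr_ge0 ?exprn_ge0 ?(ltW l0) //.
    exact: (Sword0_ge0 [:: a m]).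
  exists 1 => _ [m _ <-]; apply: (@le_trans _ _ (\sum_i u m 0 i)).
    by rewrite (bigD1 i) //= lerDl sumr_ge0 // => j _; exact: Sword0_ge0.
  by rewrite sum_Sword0 gerBl exprn_ge0 // ltW.
pose c : 'rV[R]_n.+1 := \row_i limn (fun m => u m 0 i).
have u_lim i : (fun m => u m 0 i) @ \oo --> c 0 i by rewrite mxE; exact: u_cvg.
exists c; split; [split=> [i|]|].
- by rewrite mxE; apply: limr_ge => //; near=> m; exact: Sword0_ge0.
- have sum_lim : (fun m => \sum_i u m 0 i) @ \oo --> \sum_i c 0 i.
    by apply: cvg_big => [|i _]; first exact: add_continuous.
  have sumE : (fun m => \sum_i u m 0 i) = (fun m => 1 - lam ^+ m * 1).
    by apply/funext => m; rewrite /u sum_Sword0 size_mkseq mulr1.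
  have lim1 : (fun m => 1 - lam ^+ m * 1) @ \oo --> (1 - 0 : R).
    apply: cvgB; first exact: cvg_cst.
    by apply: cvg_expM0; rewrite ltW.
  by rewrite subr0 -sumE in lim1; exact: (cvg_unique (@Rhausdorff R) sum_lim lim1).
have lim : (fun j => Scomp lam p a j 0) @ \oo --> c *m mix p.
  rewrite mix_sum (_ : (fun j => _) = (fun j => \sum_i u j 0 i *: p i)).
    apply: cvg_big => [|i _]; first exact: add_continuous.
    by apply: cvgZr_tmp; exact: u_lim.
  by apply/funext => j; rewrite ScompE -[in LHS](mul0mx _ (mix p)) Sword_mix mix_sum.
exact: (cvg_unique (@norm_hausdorff _ _) h lim).
Unshelve. all: by end_near.
Qed.

(** * Interior of the convex hull *)

Lemma affine_coordinates (R : realType) d n (p : 'I_n.+1 -> 'rV[R]_d) :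
  not_in_affine_hyperplane p ->
  exists G : 'M[R]_(d, n.+1), G *m mix p = 1%:M /\
    forall v : 'rV[R]_d, \sum_i (v *m G) 0 i = 0.
Proof.
(* With 1 appended to each point, [P] has independent columns: a relation [(a, c)] would put all
   points on a hyperplane. The first d rows of a left inverse express vectors by coefficients of sum
   0. *)
move=> hp; pose P : 'M[R]_(n.+1, d + 1) := row_mx (mix p) (const_mx 1).
have free : row_free P^T.
  rewrite -kermx_eq0; apply/negPn/negP => /rowV0Pn[u /sub_kermxP uP u0].
  pose a := lsubmx u; pose c := rsubmx u 0 0.
  have ua i : \sum_(j < d) a 0 j * p i 0 j = - c.
    apply/eqP; rewrite -addr_eq0; apply/eqP.
    transitivity ((u *m P^T) 0 i); last by rewrite uP mxE.
    rewrite -[u]hsubmxK tr_row_mx mul_row_col !mxE big_ord1 !mxE mulr1.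
    congr (_ + _); last by rewrite /c mxE.
    by apply: eq_bigr => j _; rewrite !mxE.
  apply: hp; exists a, (- c); split=> //.
  apply: contraNneq u0 => a0; have := ua ord0; rewrite a0.
  under eq_bigr do rewrite mxE mul0r.
  rewrite sumr_const mul0rn => /esym/eqP; rewrite oppr_eq0 => /eqP c0.
  rewrite -[u]hsubmxK -/a a0; apply/eqP/rowP => j; rewrite mxE.
  by case: splitP => k _; rewrite ?ord1 -?/c ?c0 !mxE.
have /row_freeP[B BE] := free.
have {}BE : B^T *m P = 1%:M by rewrite -[P]trmxK -trmx_mul BE trmx1.
exists (usubmx B^T).
have uE : usubmx B^T *m P = usubmx 1%:M by rewrite mul_usub_mx BE.
rewrite mul_mx_row scalar_mx_block /block_mx col_mxKu in uE.
have [E1 E2] := eq_row_mx uE; split=> // v.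
have <- : (v *m (usubmx B^T *m (const_mx 1 : 'cV[R]_n.+1))) 0 0 = \sum_i (v *m usubmx B^T) 0 i.
  by rewrite mulmxA [LHS]mxE; apply: eq_bigr => i _; rewrite [const_mx _ _ _]mxE mulr1.
by rewrite E2 mulmx0 mxE.
Qed.

Lemma positive_interior (R : realType) d n (p : 'I_n.+1 -> 'rV[R]_d)
    (X : set 'rV[R]_d) (c : 'rV[R]_n.+1) :
  not_in_affine_hyperplane p -> (forall c, simplex c -> X (c *m mix p)) ->
  (forall i, 0 < c 0 i) -> \sum_i c 0 i = 1 -> interior X (c *m mix p).
Proof.
move=> /affine_coordinates[G [GP Gsum]] hX c0 c1.
(* A displacement [v] changes each weight by at most [K] times its norm; the 1 keeps [K]
   positive. *)
pose K := 1 + \sum_i \sum_j `|G j i|.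
have K0 : 0 < K.
  by rewrite ltr_pwDl // sumr_ge0 // => i _; rewrite sumr_ge0.
pose x := \big[Num.min/1]_i c 0 i.
have x0 : 0 < x by apply: lt_bigmin => // i _.
have e0 : 0 < x / K by rewrite divr_gt0.
apply/nbhs_ballP; exists (x / K) => //= y [_ hy].
pose v := y - c *m mix p.
have -> : y = (c + v *m G) *m mix p by rewrite mulmxDl -mulmxA GP mulmx1 addrC subrK.
apply: hX; split=> [i|]; last first.
  under eq_bigr do rewrite mxE.
  by rewrite big_split /= c1 Gsum addr0.
have vle j : `|v 0 j| <= x / K.
  rewrite ltW // /v 2!mxE distrC; exact: hy.
have vG : `|(v *m G) 0 i| <= x.
  rewrite mxE; apply: le_trans (ler_norm_sum _ _ _) _.
  apply: (@le_trans _ _ (\sum_j x / K * `|G j i|)).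
    by apply: ler_sum => j _; rewrite normrM ler_wpM2r.
  rewrite -mulr_sumr mulrAC ler_pdivrMr // ler_wpM2l ?(ltW x0) // /K.
  rewrite (bigD1 i) //= addrCA lerDl addr_ge0 // sumr_ge0 // => k _.
  by rewrite sumr_ge0.
have xc : x <= c 0 i by exact: bigmin_le.
rewrite mxE; move: vG; rewrite ler_norml => /andP[h _]; lra.
Qed.

(** Push [x] slightly away from the centroid, staying in [X]. Then [x] is a mixture of the pushed
    point and the centroid, and the latter makes every weight positive. *)
Lemma interior_positive (R : realType) d n (p : 'I_n.+1 -> 'rV[R]_d)
    (X : set 'rV[R]_d) x :
  (forall y, X y -> exists c, simplex c /\ y = c *m mix p) ->
  interior X x ->
  exists c : 'rV[R]_n.+1, [/\ forall i, 0 < c 0 i, \sum_i c 0 i = 1 & x = c *m mix p].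
Proof.
move=> hX /nbhs_normP[e /= e0 he].
pose b : 'rV[R]_n.+1 := const_mx n.+1%:R^-1.
have b1 : \sum_i b 0 i = 1.
  under eq_bigr do rewrite mxE.
  by rewrite sumr_const card_ord -[_^-1]mulr1 -mulrnAr mulVf // pnatr_eq0.
pose w := x - b *m mix p; pose h := e / (1 + `|w|).
have w0 : 0 < 1 + `|w| by rewrite ltr_pwDl.
have h0 : 0 < h by rewrite divr_gt0.
have h1 : 1 + h != 0 by rewrite gt_eqF // addr_gt0.
have [|c [[c0 c1] yE]] := hX (x + h *: w).
  apply: he; rewrite /= opprD addrA subrr sub0r normrN normrZ gtr0_norm //.
  by rewrite mulrAC ltr_pdivrMr // ltr_pM2l // ltrDr.
exists ((1 + h)^-1 *: (c + h *: b)); split=> [i||].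
- rewrite mxE mulr_gt0 ?invr_gt0 ?addr_gt0 // mxE ltr_wpDl // mxE mulr_gt0 //.
  by rewrite mxE invr_gt0.
- under eq_bigr do rewrite 3!mxE.
  by rewrite -mulr_sumr big_split /= -mulr_sumr b1 c1 mulr1 mulVf.
rewrite -scalemxAl mulmxDl -yE -scalemxAl /w.
have -> : x + h *: (x - b *m mix p) + h *: (b *m mix p) = (1 + h) *: x.
  by rewrite scalerBr addrA subrK scalerDl scale1r.
by rewrite scalerA mulVf // scale1r.
Qed.

(** The origin may lie outside [X], so the maps are applied to a point [y] of [X]; the difference
    [lam ^+ m *: y] vanishes in the limit. *)
Lemma coding_in_attractor (R : realType) d n (lam : R) (p : 'I_n.+1 -> 'rV[R]_d)
    (X : set 'rV[R]_d) a x :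
  0 <= lam < 1 -> X !=set0 -> closed X -> (forall i y, X y -> X (Smap lam p i y)) ->
  is_coding lam p a x -> X x.
Proof.
move=> l01 [y Xy] cX SX h.
have lim : (fun m => Sword lam p (mkseq a m) y) @ \oo --> x.
  have -> : (fun m => Sword lam p (mkseq a m) y)
      = (fun m => (lam ^+ m * 1) *: y + Scomp lam p a m 0).
    by apply/funext => m; rewrite Sword_affine size_mkseq mulr1 ScompE.
  have := cvgD (cvgZr_tmp (a := y) (cvg_expM0 1 l01)) h.
  rewrite scale0r add0r => lim_x. exact: lim_x.
apply: (closed_cvg X cX _ x lim); near=> m.
by rewrite /Sword; elim: (mkseq a m) => //= i w; exact: SX.
Unshelve. all: by end_near.
Qed.

Lemma attractor_coding (R : realType) d n (lam : R) (p : 'I_n.+1 -> 'rV[R]_d)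
    (X : set 'rV[R]_d) x :
  0 <= lam < 1 -> compact X ->
  X `<=` \bigcup_(i in [set: 'I_n.+1]) (Smap lam p i @` X) ->
  X x -> exists a, is_coding lam p a x.
Proof.
move=> l01 /compact_bounded[C [_ hC]] XS Xx.
have step y : X y -> exists i y', X y' /\ y = Smap lam p i y'.
  by move=> /XS[i _ [y' Xy' <-]]; exists i, y'.
have [a ha] := exists_orbit step Xx.
exists a; apply: (coding_of_bounded (C := C + 1)) => // m.
have [y' [Xy' ->]] := ha m; exists y'; split=> //.
by apply: hC Xy'; rewrite ltrDl.
Qed.

Lemma Sword_positive (R : realType) n (lam : R) (w : seq 'I_n.+1) c i :
  0 < lam < 1 -> simplex c -> i \in w -> 0 < Sword lam (@vtx R n) w c 0 i.
Proof.
move=> /andP[l0 l1] sc; have l01 : 0 <= lam <= 1 by rewrite !ltW.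
elim: w => //= j w IH; rewrite in_cons Smap_vtxE => /orP[/eqP->|iw].
  rewrite eqxx mulr1 ltr_wpDl ?subr_gt0 // mulr_ge0 ?(ltW l0) //.
  by case: (simplex_Sword w l01 sc).
by rewrite ltr_pwDl ?mulr_gt0 ?IH // mulr_ge0 // subr_ge0 ltW.
Qed.

Theorem theorem1p1 (R : realType) (d n : nat) (p : 'I_n.+1 -> 'rV[R]_d)
  (k : nat) :
  (1 <= k)%N ->
  not_in_affine_hyperplane p ->
  exists delta : R, 0 < delta /\
    forall lam : R, 0 < lam -> 1 - delta < lam -> lam < 1 ->
    forall X : set 'rV[R]_d,
      X !=set0 -> compact X ->
      X = \bigcup_(i in [set: 'I_n.+1]) (Smap lam p i @` X) ->
      Xk lam p k X = interior X.
Proof.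
move=> k0 hp; have [delta [delta0 ndelta nc]] := normal_coded_positive R n k0.
exists delta; split=> // lam l0 ld l1 X X0 cX XE.
have l01 : 0 <= lam < 1 by rewrite ltW.
have l01' : 0 < lam < 1 by rewrite l0.
have Xcl : closed X := compact_closed (@norm_hausdorff _ _) cX.
have SX i y : X y -> X (Smap lam p i y).
  by move=> Xy; rewrite XE; exists i => //; exists y.
have in_X a x : is_coding lam p a x -> X x := coding_in_attractor l01 X0 Xcl SX.
(* This fact and [X_hull] identify [X] with the convex hull of the points. *)
have hull_X c : simplex c -> X (c *m mix p).
  move=> sc; have [|a ha] := simplex_coding p l01' _ sc; last exact: in_X ha.
  by apply: le_trans ndelta; rewrite ler_pM2l //; lra.
have X_hull x : X x -> exists c, simplex c /\ x = c *m mix p.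
  move=> Xx; have [|a] := attractor_coding (p := p) l01 cX _ Xx.
    by rewrite {1}XE.
  exact: coding_simplex.
apply/seteqP; split=> x.
  move=> [_ [a [ax an]]].
  have [t ht] := choice (fun i => simply_normal_occurs i k0 an).
  (* The prefix of length [m] contains every digit, so it makes all weights positive; the successor
     is there because positions start at 0. *)
  pose m := (\max_i t i).+1.
  have [y [-> /in_X/X_hull[c [sc ->]]]] := coding_shift m l0 ax.
  rewrite Sword_mix; apply: positive_interior => //.
    move=> i; apply: Sword_positive => //; rewrite -(ht i); apply: map_f.
    by rewrite mem_iota /= add0n ltnS leq_bigmax.
  by apply: (simplex_Sword _ _ sc).2; rewrite !ltW.
move=> xX; split; first exact: interior_subset.
have [c [c0 c1 ->]] := interior_positive X_hull xX.
exact/normal_coded_coding/nc.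
Qed.
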